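(* Let $t,\omega$ be integers with $\omega\geq 6$ and $t\geq\omega+1$. Then $$(\omega-1)(t-1)+1\leq \operatorname{gr}_4(P_5:PA_{t,\omega})\leq 3\operatorname{R}_2(PA_{t,\omega})-2 .$$
   Context: All graphs are finite, simple and undirected. $K_n$ is the complete graph on $n$ vertices and $P_5$ is the path with $5$ vertices and $4$ edges. For $t\geq\omega+1$, the pineapple $PA_{t,\omega}$ is the graph of order $t$ obtained from the complete graph $K_\omega$ by attaching $t-\omega$ pendent vertices to one and the same vertex of $K_\omega$. An edge-colored graph is rainbow if all its edges have different colors and monochromatic if all its edges have a single color. A copy of a graph means a (not necessarily induced) subgraph isomorphic to it. $\operatorname{R}_2(H)$ is the classical two-color Ramsey number: the minimum $n$ such that every coloring of the edges of $K_n$ with two colors contains a monochromatic copy of $H$. In the definition of Gallai-Ramsey numbers, a $k$-edge-coloring assigns to each edge one of $k$ colors and is assumed exact, i.e. each of the $k$ colors is used at least once. For non-empty graphs $G,H$ (graphs with at least one edge) and a positive integer $k$, the Gallai-Ramsey number $\operatorname{gr}_k(G:H)$ is the minimum integer $N$ with $\binom{N}{2}\geq k$ (so that $K_N$ admits a $k$-edge-coloring) such that for all $n\geq N$, every $k$-edge-coloring of $K_n$ contains either a rainbow copy of $G$ or a monochromatic copy of $H$. *)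

(* Defs.v *)
From mathcomp Require Import all_boot.
From mathcomp Require Import boolp.

Set Implicit Arguments.
Unset Strict Implicit.
Unset Printing Implicit Defensive.

Record sgraph := SGraph {
  vertex :> finType;
  adj : rel vertex;
  adj_sym : symmetric adj;
  adj_irr : irreflexive adj }.

Definition edges (G : sgraph) : {set {set G}} :=
  [set [set p.1; p.2] | p in [pred p : G * G | adj p.1 p.2]].

Section Complete.
Variable n : nat.
Definition complete_adj : rel 'I_n := fun i j => i != j.
Lemma complete_sym : symmetric complete_adj.
Proof. by move=> i j; rewrite /complete_adj eq_sym. Qed.
Lemma complete_irr : irreflexive complete_adj.
Proof. by move=> i; rewrite /complete_adj eqxx. Qed.
Definition complete : sgraph := SGraph complete_sym complete_irr.
End Complete.

Section Path.
Variable n : nat.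
Definition path_adj : rel 'I_n := fun i j => (i.+1 == j) || (j.+1 == i).
Lemma path_sym : symmetric path_adj.
Proof. by move=> i j; rewrite /path_adj orbC. Qed.
Lemma path_irr : irreflexive path_adj.
Proof. by move=> i; rewrite /path_adj orbb -[X in _ == X]addn0 -addn1 eqn_add2l. Qed.
Definition path_graph : sgraph := SGraph path_sym path_irr.
End Path.

(* The clique is on the vertices 0, ..., w - 1; the vertices w, ..., t - 1 are
   the pendent ones, all attached to the vertex 0. *)
Section Pineapple.
Variables t w : nat.
Definition pineapple_adj : rel 'I_t := fun i j =>
  (i != j) && [|| (i < w) && (j < w),
                  (i == 0 :> nat) && (w <= j) | (j == 0 :> nat) && (w <= i)].
Lemma pineapple_sym : symmetric pineapple_adj.
Proof.
move=> i j; rewrite /pineapple_adj eq_sym; congr (_ && _).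
by rewrite [(j < w) && _]andbC; congr (_ || _); rewrite orbC.
Qed.
Lemma pineapple_irr : irreflexive pineapple_adj.
Proof. by move=> i; rewrite /pineapple_adj eqxx. Qed.
Definition pineapple : sgraph := SGraph pineapple_sym pineapple_irr.
End Pineapple.

(* Only the values on the edges of the complete graph (the two-element subsets)
   are ever looked at. *)
Definition coloring (n k : nat) := {set complete n} -> 'I_k.

Definition exact n k (c : coloring n k) : Prop :=
  forall a : 'I_k, exists2 e, e \in edges (complete n) & c e = a.

(* A copy of G in the complete graph is given by an injection f of its vertices;
   its edges are the images f @: e of the edges e of G. *)
Definition rainbow_copy (G : sgraph) n k (c : coloring n k) : Prop :=
  exists2 f : G -> complete n, injective f &
    {in edges G &, injective (fun e : {set G} => c (f @: e))}.

Definition monochromatic_copy (H : sgraph) n k (c : coloring n k) : Prop :=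
  exists2 f : H -> complete n, injective f &
    exists a : 'I_k, forall e, e \in edges H -> c (f @: e) = a.

(* Least natural number satisfying P; the value is 0 when there is none. *)
Definition minimum (P : nat -> Prop) : nat :=
  if pselect (exists n, `[< P n >]) is left exP then ex_minn exP else 0.

Lemma minimumP (P : nat -> Prop) (n : nat) : P n ->
  P (minimum P) /\ forall m, P m -> minimum P <= m.
Proof.
move=> Pn; rewrite /minimum; case: pselect => [exP|]; last first.
  by case; exists n; apply/asboolP.
case: ex_minnP => m /asboolP Pm min_m; split=> // p Pp.
by apply: min_m; apply/asboolP.
Qed.

(* Colorings are not required to be exact here, unlike in gallai_ramsey. *)
Definition ramsey2 (H : sgraph) : nat :=
  minimum (fun n => forall c : coloring n 2, monochromatic_copy H c).

Definition gallai_ramsey (k : nat) (G H : sgraph) : nat :=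
  minimum (fun N => k <= 'C(N, 2) /\
    forall n, N <= n -> forall c : coloring n k, exact c ->
      rainbow_copy G c \/ monochromatic_copy H c).

(* Main.v *)
(* Upper bound. Take a 4-coloured K_n without rainbow P_5.
   - If no vertex sees three colours, the colour sets at two vertices always meet
     (in the colour of the edge joining them), which forces one colour d such that
     every vertex sees at most one other colour. Merging the colours other than d
     and applying the two-colour Ramsey property gives a pineapple that is
     d-coloured or d-free; in the second case connectedness makes it monochromatic.
   - If v sees colours 1, 2, 3 at a, b, c, inspecting the paths around an edge of
     the fourth colour shows that deleting at most 5 vertices leaves a
     monochromatic complete graph, and n - 5 >= t.
   Lower bound. Split (w-1)(t-1) vertices into w-1 blocks of size t-1, use colour 0
   between the blocks and one of the colours 1, 2, 3 inside each block. *)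
Require Import Defs.
From mathcomp Require Import all_boot.
From mathcomp Require Import boolp zify.

Set Implicit Arguments.
Unset Strict Implicit.
Unset Printing Implicit Defensive.

Ltac permute kP := let T := fresh "T" in
  case: kP => -[? ? ?] [[? ? ?] T]; split; [|split]; try (by split; congruence);
  let x := fresh "x" in move=> x; case: (T x) => ->;
  first [by apply: Or41 | by apply: Or42 | by apply: Or43 | by apply: Or44].

(** * Colourings without a rainbow P_5 in which some vertex sees three colours *)

Section NoRainbowPath.
Variables (V : finType) (C : eqType) (col : V -> V -> C).
Hypothesis colC : forall x y, col x y = col y x.

(** Explicit disequalities replace an injective map, so that [congruence] can close every side
    condition once [rainbow] names the five vertices. *)
Definition rainbow_free := forall p0 p1 p2 p3 p4 : V,
  p0 <> p1 -> p0 <> p2 -> p0 <> p3 -> p0 <> p4 -> p1 <> p2 -> p1 <> p3 ->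
  p1 <> p4 -> p2 <> p3 -> p2 <> p4 -> p3 <> p4 ->
  col p0 p1 <> col p1 p2 -> col p0 p1 <> col p2 p3 -> col p0 p1 <> col p3 p4 ->
  col p1 p2 <> col p2 p3 -> col p1 p2 <> col p3 p4 -> col p2 p3 <> col p3 p4 ->
  False.

(** Colours are named by variables, so that symmetric cases are settled by permuting the names. *)
Definition palette (k1 k2 k3 k4 : C) :=
  [/\ k1 <> k2, k1 <> k3 & k1 <> k4] /\ [/\ k2 <> k3, k2 <> k4 & k3 <> k4] /\
  forall x, [\/ x = k1, x = k2, x = k3 | x = k4].

Definition star (k1 k2 k3 : C) (v a b c : V) :=
  [/\ v <> a, v <> b & v <> c] /\ [/\ col v a = k1, col v b = k2 & col v c = k3].

Definition almost_mono := exists k (S : seq V), size S <= 5 /\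
  forall x y, x \notin S -> y \notin S -> x <> y -> col x y = k.

Hypothesis rf : rainbow_free.

Ltac rainbow p0 p1 p2 p3 p4 :=
  exfalso; apply: (rf (p0 := p0) (p1 := p1) (p2 := p2) (p3 := p3) (p4 := p4));
  pose proof (colC p0 p1); pose proof (colC p1 p2);
  pose proof (colC p2 p3); pose proof (colC p3 p4); congruence.

Lemma palette_swap k1 k2 k3 k4 : palette k1 k2 k3 k4 -> palette k1 k3 k2 k4.
Proof. by move=> kP; permute kP. Qed.

Lemma palette_rot3 k1 k2 k3 k4 : palette k1 k2 k3 k4 -> palette k2 k3 k1 k4.
Proof. by move=> kP; permute kP. Qed.

Lemma palette_rot k1 k2 k3 k4 : palette k1 k2 k3 k4 -> palette k2 k3 k4 k1.
Proof. by move=> kP; permute kP. Qed.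

(** * An edge of the fourth colour disjoint from a three-coloured star *)

Section DisjointEdge.
Variables (k1 k2 k3 k4 : C) (v a b c : V).
Hypothesis kP : palette k1 k2 k3 k4.
Hypothesis sP : star k1 k2 k3 v a b c.

Definition off x := [/\ x <> v, x <> a, x <> b & x <> c].

(** Paths from [y] through [x], one leaf, [v] and another leaf show that the edge from [x] to each
    leaf has colour [k4] or the star colour of that leaf. A mixture is excluded by paths such as
    [b, v, c, x, a], with [c x] of colour [k4] and [x a] of colour [k1]. *)
Lemma disjoint_edge_dichotomy x y : off x -> off y -> x <> y -> col x y = k4 ->
  [/\ col x a = k4, col x b = k4 & col x c = k4] \/
  [/\ col x a = k1, col x b = k2 & col x c = k3].
Proof.
case: kP sP => -[? ? ?] [[? ? ?] T] [[? ? ?] [? ? ?]].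
move=> [? ? ? ?] [? ? ? ?] ? ?.
have [xa|xa] : col x a = k1 \/ col x a = k4.
  case: (T (col x a)) => E; [by left| | |by right].
    by rainbow y x a v c.
  by rainbow y x a v b.
- right; case: (T (col x b)) => E.
  + by rainbow y x b v c.
  + case: (T (col x c)) => F; first by rainbow y x c v b.
    * by rainbow y x c v a.
    * by [].
    * by rainbow b v c x a.
  + by rainbow y x b v a.
  + by rainbow c v b x a.
- left; case: (T (col x b)) => E.
  + by rainbow y x b v c.
  + by rainbow c v a x b.
  + by rainbow y x b v a.
  case: (T (col x c)) => F; first by rainbow y x c v b.
  + by rainbow y x c v a.
  + by rainbow b v a x c.
  by [].
Qed.

(** If [x] copied the star colours, [b c] could only be [k2] or [k3]. The dichotomy applied to [y]
    then gives a rainbow path in each of its two cases. *)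
Lemma disjoint_edge_star x y : off x -> off y -> x <> y -> col x y = k4 ->
  [/\ col x a = k4, col x b = k4 & col x c = k4].
Proof.
move=> ox oy xy cxy.
have cyx : col y x = k4 by rewrite colC.
case: (disjoint_edge_dichotomy ox oy xy cxy) => // -[xa xb xc].
have := disjoint_edge_dichotomy oy ox (nesym xy) cyx.
case: kP sP ox oy => -[? ? ?] [[? ? ?] T] [[? ? ?] [? ? ?]] [? ? ? ?] [? ? ? ?].
have bc : col b c <> k1 /\ col b c <> k4.
  by split=> E; [rainbow y x b c v | rainbow a v b c x].
case=> -[ya yb yc]; case: (T (col b c)) => E; try by case: bc.
- by rainbow y a v c b.
- by rainbow y a v b c.
- by rainbow a x y c b.
- by rainbow a x y b c.
Qed.

(** All edges from [x] to the leaves have colour [k4], so a colour [k1] on [x z] makes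
    [b, v, c, x, z] rainbow; [k2] and [k3] fail in the same way. *)
Lemma disjoint_edge_off x y z : off x -> off y -> x <> y -> col x y = k4 ->
  off z -> x <> z -> col x z = k4.
Proof.
move=> ox oy xy cxy.
have [] := disjoint_edge_star ox oy xy cxy.
case: kP sP ox oy => -[? ? ?] [[? ? ?] T] [[? ? ?] [? ? ?]] [? ? ? ?] [? ? ? ?].
move=> xa xb xc [? ? ? ?] ?; case: (T (col x z)) => // E.
- by rainbow b v c x z.
- by rainbow a v c x z.
- by rainbow a v b x z.
Qed.

Lemma disjoint_edge_mono x y z u : off x -> off y -> x <> y -> col x y = k4 ->
  off z -> off u -> z <> u -> col z u = k4.
Proof.
move=> ox oy xy cxy oz ou zu.
have [xz|/eqP xz] := eqVneq x z.
  by rewrite -xz in zu *; apply: (disjoint_edge_off ox oy xy).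
(* The edge [z x] has colour [k4] too, so [z] can take over the role of [x]. *)
apply: (disjoint_edge_off oz ox (nesym xz)) => //.
by rewrite colC; apply: (disjoint_edge_off ox oy xy).
Qed.

End DisjointEdge.

Lemma notin_offP v a b c x : x \notin [:: v; a; b; c] -> off v a b c x.
Proof. by rewrite !inE !negb_or => /and4P[/eqP ? /eqP ? /eqP ? /eqP ?]. Qed.

Lemma disjoint_edge k1 k2 k3 k4 v a b c x y :
  palette k1 k2 k3 k4 -> star k1 k2 k3 v a b c ->
  off v a b c x -> off v a b c y -> x <> y -> col x y = k4 -> almost_mono.
Proof.
move=> kP sP ox oy xy cxy; exists k4, [:: v; a; b; c]; split=> // z u oz ou.
exact: (disjoint_edge_mono kP sP ox oy xy cxy (notin_offP oz) (notin_offP ou)).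
Qed.

Lemma fresh (s : seq V) : size s < #|V| -> exists z, z \notin s.
Proof.
move=> ltsV; apply/existsP; rewrite -negb_forall; apply: contraTN ltsV => /forallP sV.
rewrite -leqNgt; apply: leq_trans (card_size s); apply/subset_leq_card/subsetP=> x _.
exact: sV.
Qed.

Hypothesis V9 : 9 <= #|V|.
Hypothesis nam : ~ almost_mono.

Lemma no_disjoint_edge k1 k2 k3 k4 v a b c x y :
  palette k1 k2 k3 k4 -> star k1 k2 k3 v a b c ->
  off v a b c x -> off v a b c y -> x <> y -> col x y <> k4.
Proof. by move=> kP sP ox oy xy cxy; apply/nam/(disjoint_edge kP sP ox oy). Qed.

(** Take an edge that avoids [v] and its four neighbours. Whatever its colour, the other three
    colours form a star at [v] disjoint from it. *)
Lemma no_full_star k1 k2 k3 k4 v a b c d : palette k1 k2 k3 k4 ->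
  star k1 k2 k3 v a b c -> v <> d -> col v d <> k4.
Proof.
move=> kP sP vd cvd.
have [x /[!inE]] : exists x, x \notin [:: v; a; b; c; d].
  by apply: fresh; apply: leq_trans V9.
rewrite !negb_or => /and5P[/eqP xv /eqP xa /eqP xb /eqP xc /eqP xd].
have [y /[!inE]] : exists y, y \notin [:: v; a; b; c; d; x].
  by apply: fresh; apply: leq_trans V9.
rewrite !negb_or => /and5P[/eqP yv /eqP ya /eqP yb /eqP yc /andP[/eqP yd /eqP yx]].
have kP2 := palette_rot kP; have kP3 := palette_rot kP2; have kP4 := palette_rot kP3.
case: (sP) => -[? ? ?] [? ? ?]; case: kP => _ [_ T].
have xy := nesym yx.
case: (T (col x y)) => E.
- by apply: (no_disjoint_edge (v := v) (a := b) (b := c) (c := d) kP2 _ _ _ xy E).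
- by apply: (no_disjoint_edge (v := v) (a := c) (b := d) (c := a) kP3 _ _ _ xy E).
- by apply: (no_disjoint_edge (v := v) (a := d) (b := a) (c := b) kP4 _ _ _ xy E).
- by apply: (no_disjoint_edge (v := v) (a := a) (b := b) (c := c) (palette_rot kP4) _ _ _ xy E).
Qed.

(** * Edges of the fourth colour between two neighbours of [v] in the same colour *)

Section SameColor.
Variables (k1 k2 k3 k4 : C) (v a x b c z : V).
Hypothesis kP : palette k1 k2 k3 k4.
Hypothesis sP : star k1 k2 k3 v a b c.
Hypotheses (vx : v <> x) (ax : a <> x) (cvx : col v x = k1) (cax : col a x = k4).
Hypothesis other : forall y, v <> y -> a <> y -> x <> y -> col v y = k2 \/ col v y = k3.
Hypotheses (vz : v <> z) (bz : b <> z) (cvz : col v z = k2).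

Lemma same_color_bc : col b c <> k4.
Proof.
move=> cbc; case: (sP) => -[va vb vc] [cva cvb cvc].
case: (kP) => -[? ? ?] [[? ? ?] T].
(* A second [k3]-neighbour [y] of [v] would give the star with leaves [a, z, y], disjoint from the
   [k4]-edge [b c]. *)
have c_only y : v <> y -> col v y = k3 -> y = c.
  move=> vy cvy; have [//|/eqP yc] := eqVneq y c.
  exfalso; apply: (no_disjoint_edge (v := v) (a := a) (b := z) (c := y) kP _ _ _ _ cbc).
  - by split; split; congruence.
  - by split; congruence.
  - by split; congruence.
  - congruence.
(* All vertices outside this list are now [k2]-neighbours of [v]. A pair of them coloured [k1] or
   [k3] extends through [v] to a rainbow path ending in the [k4]-edge [c b] or [a x]. *)
apply: nam; exists k2, [:: v; a; x; b; c]; split=> // p q.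
rewrite !inE !negb_or => /and5P[/eqP pv /eqP pa /eqP px /eqP pb /eqP pc].
move=> /and5P[/eqP qv /eqP qa /eqP qx /eqP qb /eqP qc] pq.
have cvp : col v p = k2.
  by case: (other (nesym pv) (nesym pa) (nesym px)) => // /(c_only _ (nesym pv)).
have cvq : col v q = k2.
  by case: (other (nesym qv) (nesym qa) (nesym qx)) => // /(c_only _ (nesym qv)).
case: (T (col p q)) => // E.
- by rainbow p q v c b.
- by rainbow p q v a x.
- by exfalso; apply: (no_disjoint_edge kP sP _ _ pq E).
Qed.

Lemma same_color_bc1 : col b c = k1.
Proof.
have := same_color_bc; case: (sP) => -[va vb vc] [cva cvb cvc].
case: (kP) => -[? ? ?] [[? ? ?] T].
case: (T (col b c)) => // E _.
- by rainbow x a v c b.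
- by rainbow x a v b c.
Qed.

End SameColor.

(** With two [k2]-neighbours [b] and [z], both [b c] and [z c] have colour [k1]; each of the four
    colours of [a b] then completes a rainbow path. *)
Lemma same_color_edge_extra k1 k2 k3 k4 v a b c x z : palette k1 k2 k3 k4 ->
  star k1 k2 k3 v a b c -> v <> x -> a <> x -> col v x = k1 -> col a x = k4 ->
  (forall y, v <> y -> a <> y -> x <> y -> col v y = k2 \/ col v y = k3) ->
  v <> z -> b <> z -> col v z = k2 -> False.
Proof.
move=> kP sP vx ax cvx cax other vz bz cvz.
have cbc := same_color_bc1 kP sP vx ax cvx cax other vz bz cvz.
case: (sP) => -[va vb vc] [cva cvb cvc].
have sP' : star k1 k2 k3 v a z c by split; split.
have czc := same_color_bc1 kP sP' vx ax cvx cax other vb (nesym bz) cvb.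
case: (kP) => -[? ? ?] [[? ? ?] T].
case: (T (col a b)) => E.
- by rainbow x a b v c.
- by rainbow x a b c v.
- by rainbow z v x a b.
- by rainbow a b v c z.
Qed.

Lemma no_same_color_edge k1 k2 k3 k4 v a b c x : palette k1 k2 k3 k4 ->
  star k1 k2 k3 v a b c -> v <> x -> a <> x -> col v x = k1 -> col a x <> k4.
Proof.
move=> kP sP vx ax cvx cax.
case: (sP) => -[va vb vc] [cva cvb cvc]; case: (kP) => -[? ? ?] [[? ? ?] T].
(* A third [k1]-neighbour could replace [a] in the star, which would then be disjoint from the edge
   [a x]. *)
have other y : v <> y -> a <> y -> x <> y -> col v y = k2 \/ col v y = k3.
  move=> vy ay xy; case: (T (col v y)) => E; [|by left|by right|].
    exfalso; apply: (no_disjoint_edge (v := v) (a := y) (b := b) (c := c) kP _ _ _ _ cax).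
    - by split; split.
    - by split; congruence.
    - by split; congruence.
    - done.
  by case: (no_full_star kP sP vy E).
(* One more vertex repeats the colour of [b] or that of [c]; the second case is the first with [k2]
   and [k3] exchanged. *)
have [z /[!inE]] : exists z, z \notin [:: v; a; x; b; c].
  by apply: fresh; apply: leq_trans V9.
rewrite !negb_or => /and5P[/eqP zv /eqP za /eqP zx /eqP zb /eqP zc].
case: (other z (nesym zv) (nesym za) (nesym zx)) => cvz.
  exact: (same_color_edge_extra kP sP vx ax cvx cax other (nesym zv) (nesym zb) cvz).
apply: (same_color_edge_extra (b := c) (c := b) (palette_swap kP) _ vx ax cvx cax _
  (nesym zv) (nesym zc) cvz); first by split; split.
by move=> y vy ay xy; case: (other y vy ay xy); [right|left].
Qed.

(** * Edges of the fourth colour between neighbours of [v] in different colours *)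

Section CrossEdge.
Variables (k1 k2 k3 k4 : C) (v a b : V).
Hypothesis kP : palette k1 k2 k3 k4.
Hypotheses (va : v <> a) (vb : v <> b) (cva : col v a = k1) (cvb : col v b = k2).
Hypothesis cab : col a b = k4.
Hypothesis a_only : forall y, v <> y -> col v y = k1 -> y = a.

(** Colours [k1] and [k2] on [c u] are excluded by paths through the edge [a b]. Colour [k4] would
    make all vertices other than [v, a, b, c, u] a clique in colour [k2]. *)
Lemma cross_third c u : v <> c -> col v c = k3 ->
  u <> v -> u <> a -> u <> b -> u <> c -> col c u = k3.
Proof.
move=> vc cvc uv ua ub uc; case: (kP) => -[? ? ?] [[? ? ?] T].
have sP : star k1 k2 k3 v a b c by split; split.
case: (T (col c u)) => // E.
- by rainbow a b v c u.
- by rainbow b a v c u.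
have cvu : col v u = k2.
  case: (T (col v u)) => // F.
  - by case: ua; apply: a_only => //; congruence.
  - exfalso; apply: (no_same_color_edge (v := v) (a := c) (b := a) (c := b)
      (palette_rot3 (palette_rot3 kP)) _ (nesym uv) (nesym uc) F E).
    by split; split.
  - by case: (no_full_star kP sP (nesym uv) F).
have c_only y : v <> y -> col v y = k3 -> y = c.
  move=> vy cvy; have [//|/eqP yc] := eqVneq y c.
  exfalso; apply: (no_disjoint_edge (v := v) (a := a) (b := b) (c := y) kP _ _ _ _ E).
  - by split; split; congruence.
  - by split; congruence.
  - by split; congruence.
  - congruence.
have other y : y <> v -> y <> a -> y <> c -> col v y = k2.
  move=> yv ya yc; case: (T (col v y)) => // F.
  - by case: ya; apply: a_only => //; congruence.
  - by case: yc; apply: c_only => //; congruence.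
  - by case: (no_full_star kP sP (nesym yv) F).
exfalso; apply: nam; exists k2, [:: v; a; b; c; u]; split=> // p q.
rewrite !inE !negb_or => /and5P[/eqP pv /eqP pa /eqP pb /eqP pc /eqP pu].
move=> /and5P[/eqP qv /eqP qa /eqP qb /eqP qc /eqP qu] pq.
have cvp := other p pv pa pc; have cvq := other q qv qa qc.
case: (T (col p q)) => // F.
- by rainbow p q v c u.
- by rainbow p q v a b.
- by case: (no_disjoint_edge kP sP _ _ pq F).
Qed.

(** For distinct [z] and [z'], [cross_third] gives [c z] the colour [k3], and each colour of [b z]
    completes a rainbow path. *)
Lemma cross_second c z z' : v <> c -> col v c = k3 ->
  z <> v -> z <> b -> col v z = k2 -> z' <> v -> z' <> b -> col v z' = k2 -> z' = z.
Proof.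
move=> vc cvc zv zb cvz z'v z'b cvz'; case: (kP) => -[? ? ?] [[? ? ?] T].
have [//|/eqP zz'] := eqVneq z' z.
have ccz : col c z = k3 by apply: cross_third => //; congruence.
case: (T (col b z)) => E.
- by rainbow a b z v c.
- by rainbow c v a b z.
- by rainbow z' v a b z.
- by rainbow c z b v a.
Qed.

(** Outside [v, a, b] at most one vertex is not a [k3]-neighbour of [v]. Every pair there thus
    contains a [k3]-neighbour, and [cross_third] gives the pair colour [k3], against [nam]. *)
Lemma no_cross_edge_only c : v <> c -> col v c <> k3.
Proof.
move=> vc cvc; case: (kP) => -[? ? ?] [[? ? ?] T].
have sP : star k1 k2 k3 v a b c by split; split.
have other y : y <> v -> y <> a -> col v y = k2 \/ col v y = k3.
  move=> yv ya; case: (T (col v y)) => F; [|by left|by right|].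
  - by case: ya; apply: a_only => //; congruence.
  - by case: (no_full_star kP sP (nesym yv) F).
apply: nam; exists k3, [:: v; a; b]; split=> // p q.
rewrite !inE !negb_or => /and3P[/eqP pv /eqP pa /eqP pb].
move=> /and3P[/eqP qv /eqP qa /eqP qb] pq.
have [cvp|cvp] := other p pv pa; last by apply: cross_third => //; congruence.
have [cvq|cvq] := other q qv qa; last first.
  by rewrite colC; apply: cross_third => //; congruence.
by case: pq; apply: (cross_second vc cvc).
Qed.

End CrossEdge.

(** If [a] and [b] both have substitutes in their colours, the substituted star is disjoint from
    [a b]. Otherwise one of them is the only neighbour of [v] in its colour. *)
Lemma no_cross_edge k1 k2 k3 k4 v a b c : palette k1 k2 k3 k4 ->
  star k1 k2 k3 v a b c -> col a b <> k4.
Proof.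
move=> kP sP cab; case: (sP) => -[va vb vc] [cva cvb cvc].
have [a_only|] := pselect (forall y, v <> y -> col v y = k1 -> y = a).
  exact: (no_cross_edge_only kP va vb cva cvb cab a_only vc cvc).
move=> /existsNP[a' /not_implyP[va' /not_implyP[cva' a'a]]].
have [b_only|] := pselect (forall y, v <> y -> col v y = k2 -> y = b).
  have kP' := palette_swap (palette_rot3 kP); rewrite colC in cab.
  exact: (no_cross_edge_only kP' vb va cvb cva cab b_only vc cvc).
move=> /existsNP[b' /not_implyP[vb' /not_implyP[cvb' b'b]]].
case: (kP) => -[? ? ?] [[? ? ?] T].
apply: (no_disjoint_edge (v := v) (a := a') (b := b') (c := c) kP _ _ _ _ cab).
- by split; split; congruence.
- by split; congruence.
- by split; congruence.
- congruence.
Qed.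

Lemma no_edge_first k1 k2 k3 k4 v a b c x y : palette k1 k2 k3 k4 ->
  star k1 k2 k3 v a b c -> x <> y -> v <> x -> v <> y -> col v x = k1 ->
  col x y <> k4.
Proof.
move=> kP sP xy vx vy cvx cxy; case: (sP) => -[va vb vc] [cva cvb cvc].
have sP' : star k1 k2 k3 v x b c by split; split.
have [_ [_ T]] := kP; case: (T (col v y)) => E.
- exact: (no_same_color_edge kP sP' vy xy E cxy).
- by apply: (no_cross_edge (v := v) (a := x) (b := y) (c := c) kP _ cxy); split; split.
- by apply: (no_cross_edge (v := v) (a := x) (b := y) (c := b) (palette_swap kP) _ cxy);
    split; split.
- by case: (no_full_star kP sP vy E).
Qed.

Lemma no_fourth_color k1 k2 k3 k4 v a b c x y : palette k1 k2 k3 k4 ->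
  star k1 k2 k3 v a b c -> x <> y -> col x y <> k4.
Proof.
move=> kP sP xy cxy.
have [vx|/eqP vx] := eqVneq v x.
  by apply: (no_full_star kP sP (d := y)); rewrite vx.
have [vy|/eqP vy] := eqVneq v y.
  by apply: (no_full_star kP sP (d := x)); rewrite vy; [exact: nesym | rewrite colC].
case: (sP) => -[va vb vc] [cva cvb cvc].
have kP2 := palette_rot3 kP; have kP3 := palette_rot3 kP2.
have [_ [_ T]] := kP; case: (T (col v x)) => E.
- exact: (no_edge_first kP sP xy vx vy E cxy).
- by apply: (no_edge_first (a := b) (b := c) (c := a) kP2 _ xy vx vy E cxy); split; split.
- by apply: (no_edge_first (a := c) (b := a) (c := b) kP3 _ xy vx vy E cxy); split; split.
- by case: (no_full_star kP sP vx E).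
Qed.

End NoRainbowPath.

(** * Existence of a dominant colour *)

Section Structure.
Variables (V : finType) (C : eqType) (col : V -> V -> C).
Hypothesis colC : forall x y, col x y = col y x.

Definition dominant d := forall v a b, v <> a -> v <> b ->
  col v a <> d -> col v b <> d -> col v a = col v b.

Definition sees v k := exists2 a, v <> a & col v a = k.

Lemma palette_complete (k1 k2 k3 k4 p q : C) : palette k1 k2 k3 k4 -> p <> q ->
  exists r s, palette p q r s.
Proof.
move=> kP; have R := kP; case: R => _ [_ T].
by case: (T p) => ->; case: (T q) => -> // _; 
  first [by exists k1, k2; permute kP | by exists k1, k3; permute kP
       | by exists k1, k4; permute kP | by exists k2, k3; permute kP
       | by exists k2, k4; permute kP | by exists k3, k4; permute kP].
Qed.

Lemma local2_dominant (k1 k2 k3 k4 : C) : palette k1 k2 k3 k4 ->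
  (forall k, exists v, sees v k) ->
  (forall v p q r, sees v p -> sees v q -> sees v r -> p <> q -> p <> r -> q = r) ->
  exists d, dominant d.
Proof.
move=> kP seen local2.
have sees_edge x y : x <> y -> sees x (col x y) /\ sees y (col x y).
  by move=> xy; split; [exists y | exists x; [exact: nesym|]].
(* For distinct [x] and [y] the colour of [x y] differs from [k1] or from [k2], so one of its ends
   sees two colours. *)
have [v [p [q [pq vp vq]]]] : exists v p q, [/\ p <> q, sees v p & sees v q].
  have [k12 _ _] := kP.1; have [x x1] := seen k1; have [y y2] := seen k2.
  have [xy|/eqP xy] := eqVneq x y; first by exists x, k1, k2; split=> //; rewrite xy.
  have [xp yp] := sees_edge _ _ xy.
  have [p1|/eqP p1] := eqVneq (col x y) k1; last by exists x, (col x y), k1.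
  by exists y, k1, k2; split=> //; rewrite -p1.
have [r [s [[_ pr ps] [[qr qs rs] T]]]] := palette_complete kP pq.
have [x xr] := seen r; have [z zs] := seen s.
have [vx|/eqP vx] := eqVneq v x; first by case: qr; apply: (local2 v p) => //; rewrite vx.
have [vz|/eqP vz] := eqVneq v z; first by case: qs; apply: (local2 v p) => //; rewrite vz.
have [[vX xV] [vZ zV]] := (sees_edge _ _ vx, sees_edge _ _ vz).
have pqP y : sees v y -> y = p \/ y = q.
  move=> vy; case: (eqVneq p y) => [|/eqP py]; first by left.
  by right; apply/esym/(local2 v p).
have X := pqP _ vX; have Z := pqP _ vZ.
have [xz|/eqP xz] := eqVneq x z.
  by case: rs; apply: (local2 x (col v x)) => //; rewrite ?xz //; case: X; congruence.
have [xZ zX] := sees_edge _ _ xz.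
have xZP : col x z = r \/ col x z = col v x.
  have [|/eqP n] := eqVneq r (col x z); [by left | right].
  by apply/esym/(local2 x r) => //; case: X; congruence.
have zXP : col x z = s \/ col x z = col v z.
  have [|/eqP n] := eqVneq s (col x z); [by left | right].
  by apply/esym/(local2 z s) => //; case: Z; congruence.
(* The limits on [x] and [z] force [v x], [v z] and [x z] to share one colour, the candidate. A
   vertex [u] with two other colours misses it, so [u x] has colour [r] and [u z] colour [s], while
   [u v] brings in a third colour. *)
exists (col v x) => u a b ua ub nda ndb.
have [//|/eqP ab] := eqVneq (col u a) (col u b).
have usees k : sees u k -> k <> col v x.
  move=> uk kd; case: ab; apply: (local2 u k) => //; try congruence.
  - by exists a.
  - by exists b.
have [vu|/eqP vu] := eqVneq v u; first by case: (usees _ _ erefl); rewrite -vu.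
have [xu|/eqP xu] := eqVneq x u; first by case: (usees _ _ erefl); rewrite -xu.
have [zu|/eqP zu] := eqVneq z u.
  by case: (usees (col v z)); [rewrite -zu|case: X Z xZP zXP => ? [] ? [] ? [] ?; congruence].
have [[vU uV] [[xU uX] [zU uZ]]] :=
  (sees_edge _ _ vu, (sees_edge _ _ xu, sees_edge _ _ zu)).
have U := pqP _ vU; have := usees _ uV; have := usees _ uX; have := usees _ uZ.
have dz : col v x = col v z by case: X Z xZP zXP => ? [] ? [] ? [] ?; congruence.
move=> nZ nX nV.
have uXr : col x u = r.
  have [//|/eqP n] := eqVneq (col x u) r.
  by case: nX; apply: (local2 x r) => //; case: X; congruence.
have uZs : col z u = s.
  have [//|/eqP n] := eqVneq (col z u) s.
  by case: nZ; rewrite dz; apply: (local2 z s) => //; case: Z; congruence.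
case: rs; rewrite -uXr -uZs; apply: (local2 u (col v u)) => //; case: U; congruence.
Qed.

Theorem almost_mono_or_dominant (k1 k2 k3 k4 : C) : 9 <= #|V| ->
  rainbow_free col -> palette k1 k2 k3 k4 -> (forall k, exists v, sees v k) ->
  almost_mono col \/ exists d, dominant d.
Proof.
move=> V9 rf kP seen; have [|nam] := pselect (almost_mono col); [by left|right].
apply: (local2_dominant kP seen) => v p q r [a va cva] [b vb cvb] [c vc cvc] pq pr.
have [//|/eqP qr] := eqVneq q r; exfalso.
have [r1 [r2 P]] := palette_complete kP pq.
have [s P'] : exists s, palette p q r s.
  have R := P; case: R => _ [_ T]; case: (T r) => E; try congruence.
    by rewrite E; exists r2.
  by rewrite E; exists r1; permute P.
have [x [y xy cxy]] := seen s.
by apply: (no_fourth_color colC rf V9 nam P' (v := v) (a := a) (b := b) (c := c) _ xy cxy).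
Qed.
End Structure.

(** * Ramsey's theorem and the two-colour Ramsey number *)

Definition clique (V : finType) (e : rel V) (B : {set V}) :=
  {in B &, forall x y, x != y -> e x y}.

Definition has_clique (V : finType) (e : rel V) (A : {set V}) s :=
  exists B : {set V}, [/\ B \subset A, s <= #|B| & clique e B].

Lemma has_clique0 (V : finType) (e : rel V) A : has_clique e A 0.
Proof. by exists set0; split=> [|//|x y]; rewrite ?sub0set ?inE. Qed.

Lemma has_cliqueS (V : finType) (e : rel V) (A : {set V}) v s : symmetric e ->
  v \in A -> has_clique e [set x in A | e v x && (x != v)] s -> has_clique e A s.+1.
Proof.
move=> eC vA [B [BN sB eB]]; exists (v |: B).
have NP x : x \in B -> [/\ x \in A, e v x & x != v].
  by move=> /(subsetP BN) /[!inE] /and3P[].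
have vB : v \notin B by apply/negP => /NP[]; rewrite eqxx.
split; first by rewrite subUset sub1set vA; apply/subsetP => x /NP[].
  by rewrite cardsU1 vB.
move=> x y /setU1P[->|xB] /setU1P[->|yB] => [/eqP //|_|_|]; last exact: eB.
  by case: (NP y yB).
by rewrite eC; case: (NP x xB).
Qed.

Lemma has_clique_sub (V : finType) (e : rel V) (A A' : {set V}) s :
  A \subset A' -> has_clique e A s -> has_clique e A' s.
Proof. by move=> AA' [B [BA ? ?]]; exists B; split=> //; apply: subset_trans BA AA'. Qed.

(** Induction on [s + r]: of the neighbours and the non-neighbours of a vertex, one set keeps at
    least half of the power of two. *)
Lemma ramsey_clique (V : finType) (e : rel V) s r (A : {set V}) : symmetric e ->
  2 ^ (s + r) <= #|A| -> has_clique e A s \/ has_clique (fun x y => ~~ e x y) A r.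
Proof.
move=> eC; move: {2}(s + r) (erefl (s + r)) => m.
elim: m s r A => [|m IH] [|s] [|r] A //; try by left; apply: has_clique0.
  by right; apply: has_clique0.
move=> srm leA.
have [v vA] : exists v, v \in A.
  by apply/set0Pn; rewrite -card_gt0; apply: leq_trans leA; rewrite expn_gt0.
pose N := [set x in A | e v x && (x != v)].
pose N' := [set x in A | ~~ e v x && (x != v)].
have cardA : #|A| <= (#|N| + #|N'|).+1.
  have -> : #|A| = (#|A :\ v|).+1 by rewrite (cardsD1 v A) vA.
  rewrite ltnS -cardsUI; apply: leq_trans (leq_addr _ _).
  apply/subset_leq_card/subsetP => x.
  by rewrite !inE => /andP[-> ->]; rewrite !andbT; case: (e v x).
have [leN|leN'] : 2 ^ m <= #|N| \/ 2 ^ m <= #|N'|.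
  by move: leA cardA; rewrite srm expnS; have := expn_gt0 2 m; lia.
- have [||eN|neN] := IH s r.+1 N; try lia; first by rewrite (_ : s + r.+1 = m) //; lia.
    by left; apply: has_cliqueS vA eN.
  by right; apply: has_clique_sub neN; apply/subsetP => x /[!inE] /andP[].
- have [||eN|neN] := IH s.+1 r N'; try lia; first by rewrite (_ : s.+1 + r = m) //; lia.
    by left; apply: has_clique_sub eN; apply/subsetP => x /[!inE] /andP[].
  by right; apply: has_cliqueS vA neN => x y; rewrite eC.
Qed.

Lemma edgesP (G : sgraph) (e : {set G}) :
  reflect (exists i j, adj i j /\ e = [set i; j]) (e \in edges G).
Proof.
apply: (iffP imsetP) => [[[i j] /= ij ->]|[i [j [ij ->]]]]; first by exists i, j.
by exists (i, j).
Qed.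

Lemma monochromatic_copyP (H : sgraph) n k (c : coloring n k) :
  monochromatic_copy H c <-> exists2 f : H -> complete n, injective f &
    exists a, forall i j, adj i j -> c [set f i; f j] = a.
Proof.
split=> -[f f_inj [a fa]]; exists f => //; exists a.
  by move=> i j ij; rewrite -(fa [set i; j]) ?imsetU1 ?imset_set1 //; apply/edgesP; exists i, j.
by move=> e /edgesP[i [j [ij ->]]]; rewrite imsetU1 imset_set1; apply: fa.
Qed.

Lemma monochromatic_copy_clique (H : sgraph) n k (c : coloring n k) (B : {set 'I_n}) a :
  #|H| <= #|B| -> {in B &, forall x y, x != y -> c [set x; y] = a} ->
  monochromatic_copy H c.
Proof.
move=> HB Ba; apply/monochromatic_copyP.
pose f (i : H) : 'I_n := enum_val (widen_ord HB (enum_rank i)).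
have f_inj : injective f.
  by move=> i j /enum_val_inj/(congr1 val)/= /val_inj/enum_rank_inj.
exists f => //; exists a => i j ij; apply: Ba; rewrite ?enum_valP //.
by apply: contraTneq ij => /f_inj ->; rewrite adj_irr.
Qed.

(** [minimum] defaults to 0, so [ramsey2] has its defining property only once some [n] is known to
    work. *)
Lemma ramsey2_exists (H : sgraph) :
  exists n, forall c : coloring n 2, monochromatic_copy H c.
Proof.
exists (2 ^ (#|H| + #|H|)) => c; set n := 2 ^ _ in c *.
pose e : rel 'I_n := fun x y => c [set x; y] == ord0.
have [||[B [_ HB Be]]|[B [_ HB Be]]] := @ramsey_clique _ e #|H| #|H| [set: 'I_n].
- by move=> x y; rewrite /e setUC.
- by rewrite cardsT card_ord.
- apply: (monochromatic_copy_clique HB (a := ord0)) => x y xB yB xy.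
  exact/eqP/Be.
- apply: (monochromatic_copy_clique HB (a := ord_max)) => x y xB yB xy.
  have := Be x y xB yB xy; rewrite /e.
  by case: (c _) => -[|[|]] // i _; apply: val_inj.
Qed.

(** [ramsey2] only speaks of its own order; a larger colouring is restricted to its first
    vertices. *)
Lemma ramsey2_mono (H : sgraph) n (c : coloring n 2) :
  ramsey2 H <= n -> monochromatic_copy H c.
Proof.
move=> Rn; have [N PN] := ramsey2_exists H.
have [PR _] := minimumP (P := fun n => forall c : coloring n 2, monochromatic_copy H c) PN.
pose w (i : complete (ramsey2 H)) : complete n := widen_ord Rn i.
have [f f_inj [a fa]] := PR (fun e => c (w @: e)).
exists (w \o f); last by exists a => e eH; rewrite imset_comp; apply: fa.
by apply: inj_comp => // i j /(congr1 val)/= /val_inj.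
Qed.

Lemma ramsey2_ge (H : sgraph) : #|H| <= ramsey2 H.
Proof.
have [f f_inj _] := @ramsey2_mono H _ (fun _ => ord0) (leqnn _).
by have := leq_card f f_inj; rewrite card_ord.
Qed.

(** * From colour structure to copies of the path and the pineapple *)

Lemma rainbow_free_path n k (c : coloring n k) : ~ rainbow_copy (path_graph 5) c ->
  rainbow_free (fun x y : 'I_n => c [set x; y]).
Proof.
move=> nrc p0 p1 p2 p3 p4 ? ? ? ? ? ? ? ? ? ? C01 C02 C03 C12 C13 C23; apply: nrc.
pose s := [:: p0; p1; p2; p3; p4].
pose f (i : path_graph 5) : complete n := nth p0 s i.
have s_uniq : uniq s.
  by rewrite /= !inE !negb_or; repeat (apply/andP; split); try apply/eqP.
exists f.
  by move=> i j /eqP; rewrite nth_uniq // => /eqP/val_inj.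
(* [q] lists the colours of the four path edges. An edge is determined by its smaller end, so
   [uniq q] yields injectivity on edges. *)
pose q := [seq c [set nth p0 s m; nth p0 s m.+1] | m <- iota 0 4].
have q_uniq : uniq q.
  by rewrite /= !inE !negb_or; repeat (apply/andP; split); try apply/eqP.
have edgeE e : e \in edges (path_graph 5) -> exists m, [/\ m < 4,
    c (f @: e) = nth (c set0) q m & e = [set (inord m : 'I_5); inord m.+1]].
  have E m : m < 4 -> c (f @: [set (inord m : 'I_5); inord m.+1]) = nth (c set0) q m.
    move=> m4; rewrite imsetU1 imset_set1 /f !inordK ?(nth_map 0) ?nth_iota ?size_iota //; lia.
  case/edgesP => i [j [/orP[]/eqP ij ->]].
    have i4 : i < 4 by have := ltn_ord j; lia.
    have -> : [set i; j] = [set (inord i : 'I_5); inord i.+1] by rewrite ij !inord_val.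
    by exists i; rewrite E.
  have j4 : j < 4 by have := ltn_ord i; lia.
  have -> : [set i; j] = [set (inord j : 'I_5); inord j.+1] by rewrite ij !inord_val setUC.
  by exists j; rewrite E.
move=> e e' /edgeE[m [m4 cm eE]] /edgeE[m' [m'4 cm' e'E]] /eqP.
by rewrite cm cm' nth_uniq // eE e'E => /eqP ->.
Qed.

Lemma pineapple_star t w (i : 'I_t) (z : 'I_t) : z = 0 :> nat -> i != z ->
  pineapple_adj w z i.
Proof.
move=> z0 iz; rewrite /pineapple_adj eq_sym iz z0 /=.
by case: (ltnP i w) => wi; rewrite ?andbT ?andbF /= ?orbT //; lia.
Qed.

Lemma dominant_pineapple t w n k (c : coloring n k) d : 0 < t ->
  ramsey2 (pineapple t w) <= n -> dominant (fun x y : 'I_n => c [set x; y]) d ->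
  monochromatic_copy (pineapple t w) c.
Proof.
move=> t0 Rn dom.
pose c2 : coloring n 2 := fun e => if c e == d then ord0 else ord_max.
have /monochromatic_copyP[f f_inj [a fa]] := ramsey2_mono c2 Rn.
apply/monochromatic_copyP; exists f => //.
have [a0|a0] := eqVneq a ord0.
  exists d => i j /fa; rewrite a0 /c2; by case: eqP.
have nd i j : pineapple_adj w i j -> c [set f i; f j] <> d.
  by move=> /fa; rewrite /c2; case: eqP => // _ a0'; rewrite -a0' in a0.
pose z : pineapple t w := Ordinal t0.
have fne i j : i != j -> f i <> f j by move=> /eqP ij /f_inj.
(* Vertex 0 is adjacent to all others: two edges at it meet there, and any other edge meets one of
   them, so dominance equates all the colours. *)
have star_eq i j : i != z -> j != z -> c [set f z; f i] = c [set f z; f j].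
  move=> iz jz; apply: dom; try by apply: fne; rewrite eq_sym.
    by apply: nd; apply: pineapple_star.
  by apply: nd; apply: pineapple_star.
have edge_eq i j : pineapple_adj w i j -> i != z -> j != z ->
    c [set f i; f j] = c [set f z; f i].
  move=> ij iz jz; rewrite [in RHS]setUC; apply: dom.
  - by apply: fne; apply: contraTneq ij => ->; rewrite pineapple_irr.
  - exact: fne.
  - exact: nd.
  - by rewrite setUC; apply: nd; apply: pineapple_star.
(* If [z] is the only vertex there is no edge, and any colour serves. *)
have [o zo|all_z] := pickP [pred i : pineapple t w | i != z]; last first.
  exists d => i j /=; have /= /negbFE/eqP -> := all_z i; have /= /negbFE/eqP -> := all_z j.
  by rewrite pineapple_irr.
exists (c [set f z; f o]) => i j ij.
have [iz|iz] := eqVneq i z.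
  rewrite iz; apply: star_eq => //; apply: contraTneq ij => ->.
  by rewrite iz adj_irr.
have [jz|jz] := eqVneq j z; first by rewrite jz setUC; apply: star_eq.
by rewrite edge_eq //; apply: star_eq.
Qed.

Lemma almost_mono_copy (H : sgraph) n k (c : coloring n k) : #|H| + 5 <= n ->
  almost_mono (fun x y : 'I_n => c [set x; y]) -> monochromatic_copy H c.
Proof.
move=> Hn [a [S [S5 mono]]].
apply: (monochromatic_copy_clique (B := ~: [set x in S]) (a := a)).
  rewrite cardsCs setCK card_ord cardsE leq_subRL.
    by apply: leq_trans Hn; rewrite addnC leq_add2l (leq_trans (card_size S)).
  by apply: leq_trans (card_size S) _; lia.
by move=> x y; rewrite !inE => xS yS /eqP; apply: mono.
Qed.

Lemma exact_sees n k (c : coloring n k) a : exact c ->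
  exists v, sees (fun x y : 'I_n => c [set x; y]) v a.
Proof.
move=> /(_ a)[e /edgesP[i [j [/eqP ij ->]]] <-].
by exists i, j.
Qed.

Lemma palette_I4 : palette (@Ordinal 4 0 isT) (@Ordinal 4 1 isT)
  (@Ordinal 4 2 isT) (@Ordinal 4 3 isT).
Proof.
split; [|split]; try by split.
by case=> -[|[|[|[|]]]] // i; [apply: Or41|apply: Or42|apply: Or43|apply: Or44]; apply: val_inj.
Qed.

(** As [ramsey2] is at least [t], and [t] at least 7, the bound on [n] covers the three sizes
    required: 9, [t + 5] and [ramsey2] itself. *)
Lemma path_or_pineapple t w n (c : coloring n 4) : 6 < t ->
  3 * ramsey2 (pineapple t w) - 2 <= n -> exact c ->
  rainbow_copy (path_graph 5) c \/ monochromatic_copy (pineapple t w) c.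
Proof.
move=> t6 Rn c_exact; have [|nrc] := pselect (rainbow_copy (path_graph 5) c); [by left|right].
have tR := ramsey2_ge (pineapple t w); rewrite card_ord in tR.
have n9 : 9 <= #|'I_n| by rewrite card_ord; lia.
have colC (x y : 'I_n) : c [set x; y] = c [set y; x] by rewrite setUC.
have [am|[d dom]] := almost_mono_or_dominant colC n9 (rainbow_free_path nrc)
  palette_I4 (fun a => exact_sees a c_exact).
  by apply: almost_mono_copy am; rewrite card_ord; lia.
by apply: dominant_pineapple dom; lia.
Qed.

(** * The block colouring for the lower bound *)

Section LowerBound.
Variables t w : nat.
Hypotheses (w6 : 6 <= w) (wt : w < t).

Let n := (w - 1) * (t - 1).
Definition block (i : nat) := i %/ (t - 1).

(** The cap at 3 fits any number of blocks into colours 1, 2, 3; the first three blocks already use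
    all of them. *)
Definition block_color (b : nat) : 'I_4 := inord (minn b.+1 3).

(** Colourings are functions on sets, so a representative is picked; the value does not depend on
    the choice. *)
Definition block_coloring : coloring n 4 := fun e =>
  if [pick x in e] is Some x then
    if [forall y in e, block y == block x] then block_color (block x) else ord0
  else ord0.

Lemma block_coloringE (i j : 'I_n) : block_coloring [set i; j] =
  if block i == block j then block_color (block i) else ord0.
Proof.
rewrite /block_coloring; case: pickP => [x|/(_ i)]; last by rewrite !inE eqxx.
rewrite !inE => /orP[]/eqP ->; case: forallP => [H|H].
- by have := H j; rewrite !inE eqxx orbT eq_sym /= => ->.
- case: eqP => // E; case: H => y; apply/implyP; rewrite !inE => /orP[]/eqP -> //.
  by rewrite E.
- by have := H i; rewrite !inE eqxx /= => /eqP ->; rewrite eqxx.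
- case: eqP => // E; case: H => y; apply/implyP; rewrite !inE => /orP[]/eqP -> //.
  by rewrite E.
Qed.

Lemma block_color_neq0 b : block_color b != ord0.
Proof. by rewrite -val_eqE /= inordK; lia. Qed.

Lemma block_coloring_neq0 (i j : 'I_n) :
  (block_coloring [set i; j] != ord0) = (block i == block j).
Proof. by rewrite block_coloringE; case: (block i == _); rewrite ?block_color_neq0 ?eqxx. Qed.

Lemma block_lt (i : 'I_n) : block i < w - 1.
Proof. by rewrite /block ltn_divLR ?ltn_ord //; lia. Qed.

Lemma block_coloring_exact : exact block_coloring.
Proof.
have lt b r : b < w - 1 -> r < t - 1 -> b * (t - 1) + r < n by rewrite /n; nia.
have blockE b r : r < t - 1 -> block (b * (t - 1) + r) = b.
  by move=> rt; rewrite /block divnMDl ?divn_small ?addn0 //; lia.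
have H0 b r b' r' (Hb : b < w - 1) (Hr : r < t - 1) (Hb' : b' < w - 1) (Hr' : r' < t - 1) :
    b * (t - 1) + r <> b' * (t - 1) + r' ->
    exists2 e, e \in edges (complete n) & block_coloring e =
      if b == b' then block_color b else ord0.
  move=> ne; exists [set Ordinal (lt b r Hb Hr); Ordinal (lt b' r' Hb' Hr')].
    apply/edgesP; exists (Ordinal (lt b r Hb Hr)), (Ordinal (lt b' r' Hb' Hr')).
    by split=> //; apply/eqP => /(congr1 val).
  by rewrite block_coloringE /= !blockE.
case=> -[|[|[|[|]]]] // i.
(* Colour 0 comes from an edge between blocks 0 and 1; colours 1, 2, 3 come from edges inside blocks
   0, 1, 2. *)
- have [|||||e eE cE] := @H0 0 0 1 0; try lia.
  by exists e => //; rewrite cE; apply: val_inj.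
- have [|||||e eE cE] := @H0 0 0 0 1; try lia.
  by exists e => //; rewrite cE; apply: val_inj; rewrite /= inordK.
- have [|||||e eE cE] := @H0 1 0 1 1; try lia.
  by exists e => //; rewrite cE; apply: val_inj; rewrite /= inordK.
- have [|||||e eE cE] := @H0 2 0 2 1; try lia.
  by exists e => //; rewrite cE; apply: val_inj; rewrite /= inordK.
Qed.

(* At most one edge of a rainbow path joins two blocks, so two consecutive edges
   lie inside one block and have the same colour. *)
Lemma block_coloring_no_path : ~ rainbow_copy (path_graph 5) block_coloring.
Proof.
move=> [f f_inj frb].
pose p m : 'I_n := f (inord m : 'I_5).
have E m : f @: [set (inord m : 'I_5); inord m.+1] = [set p m; p m.+1].
  by rewrite imsetU1 imset_set1.
have ne m m' : m < m' < 4 ->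
    block_coloring [set p m; p m.+1] <> block_coloring [set p m'; p m'.+1].
  move=> mm'; rewrite -!E.
  have eE l : l < 4 -> [set (inord l : 'I_5); inord l.+1] \in edges (path_graph 5).
    move=> l4; apply/edgesP; exists (inord l), (inord l.+1); split=> //.
    by rewrite /= /path_adj !inordK ?eqxx //; lia.
  move=> /(frb _ _ (eE _ _) (eE _ _)) H.
  have /setP/(_ (inord m)) := H ltac:(lia) ltac:(lia).
  by rewrite !inE eqxx -!val_eqE /= !inordK; lia.
have step m : m < 3 -> block (p m) = block (p m.+1) -> block (p m.+1) <> block (p m.+2).
  move=> m3 b1 b2; have /ne : m < m.+1 < 4 by lia.
  by rewrite !block_coloringE b1 b2 !eqxx.
have zero m : block (p m) <> block (p m.+1) ->
    block_coloring [set p m; p m.+1] = ord0.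
  by move=> /eqP/negbTE b; rewrite block_coloringE b.
have [i [i2 bi]] : exists i, i < 2 /\ block (p i) <> block (p i.+1).
  have [b|/eqP b] := eqVneq (block (p 0)) (block (p 1)); last by exists 0.
  by exists 1; split=> //; apply: step.
have [j [j2 bj]] : exists j, 1 < j < 4 /\ block (p j) <> block (p j.+1).
  have [b|/eqP b] := eqVneq (block (p 2)) (block (p 3)); last by exists 2.
  by exists 3; split=> //; apply: step.
by apply: (ne i j); [lia | rewrite !zero].
Qed.

(** In colour 0 the [w] clique vertices would need distinct blocks among [w - 1]. In any other
    colour all [t] vertices lie in the block of vertex 0, which has only [t - 1] elements. *)
Lemma block_coloring_no_pineapple :
  ~ monochromatic_copy (pineapple t w) block_coloring.
Proof.
move=> /monochromatic_copyP[f f_inj [a fa]].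
have [a0|a0] := eqVneq a ord0.
  pose h (i : 'I_w) : 'I_(w - 1) := Ordinal (block_lt (f (widen_ord (ltnW wt) i))).
  suff /leq_card : injective h by rewrite !card_ord; lia.
  move=> i j /(congr1 val)/= hij; apply/eqP/contraT => /eqP ij.
  have /fa : adj (widen_ord (ltnW wt) i : pineapple t w) (widen_ord (ltnW wt) j).
    rewrite /= /pineapple_adj /= !ltn_ord /= andbT.
    by apply/eqP => /(congr1 val)/= /val_inj.
  by move/eqP; rewrite a0 => /negPn; rewrite block_coloring_neq0 hij eqxx.
have t0 : 0 < t by lia.
pose z : pineapple t w := Ordinal t0.
have same i : block (f i) = block (f z).
  have [-> //|iz] := eqVneq i z.
  apply/esym/eqP; rewrite -block_coloring_neq0 (fa z i) //.
  exact: pineapple_star.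
have t1 : 0 < t - 1 by lia.
pose h (i : 'I_t) : 'I_(t - 1) := Ordinal (ltn_pmod (f i) t1).
suff /leq_card : injective h by rewrite !card_ord; lia.
move=> i j /(congr1 val)/= hij; apply/f_inj/val_inj => /=.
rewrite (divn_eq (f i) (t - 1)) (divn_eq (f j) (t - 1)) hij.
by rewrite -!/(block _) !same.
Qed.
End LowerBound.

Theorem theorem4p5 (t w : nat) (hw : 6 <= w) (ht : w + 1 <= t) :
  (w - 1) * (t - 1) + 1 <= gallai_ramsey 4 (path_graph 5) (pineapple t w)
    <= 3 * ramsey2 (pineapple t w) - 2.
Proof.
have tR := ramsey2_ge (pineapple t w); rewrite card_ord in tR.
(* Exhibiting [3 * ramsey2 - 2] as a witness rules out the default value 0 of [minimum], and
   minimality then gives the upper bound. *)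
have [] := minimumP (n := 3 * ramsey2 (pineapple t w) - 2) (P := fun N => 4 <= 'C(N, 2) /\
    forall n, N <= n -> forall c : coloring n 4, exact c ->
      rainbow_copy (path_graph 5) c \/ monochromatic_copy (pineapple t w) c).
  split; last by move=> n Rn c; apply: path_or_pineapple => //; lia.
  by apply: (@leq_trans 'C(4, 2)) => //; apply: leq_bin2l; lia.
rewrite -/(gallai_ramsey 4 _ _) => -[_ grP] /(_ (3 * ramsey2 (pineapple t w) - 2)) gr_min.
apply/andP; split; last first.
  apply: gr_min; split; last by move=> n Rn c; apply: path_or_pineapple => //; lia.
  by apply: (@leq_trans 'C(4, 2)) => //; apply: leq_bin2l; lia.
rewrite addn1 ltnNge; apply/negP => gr_le.
have wt : w < t by lia.
have [] := grP _ gr_le (@block_coloring t w) (block_coloring_exact hw wt).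
  exact: block_coloring_no_path.
exact: block_coloring_no_pineapple.
Qed.
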